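(* Let $c_0$ be a proper $4$-colouring of the plane, let $\mu$ be a left-invariant finitely additive probability measure on $S_4\times E(2)$, and let $p_d$ be the associated monochromaticity probabilities (see context). Let $d>0$ be fixed, and take $5$ different points in the plane such that among the $10$ distances between pairs of them at least $8$ are equal to $1$ or $d$. Let $n$ denote the number of pairs at distance $d$. (i) If exactly two pairs have distance not in $\{1,d\}$, and these distances are $x\le y$, then $p_d\ge \frac{1-p_x-p_y}{n}$. (ii) If exactly one pair has distance not in $\{1,d\}$, and this distance is $x$, then $p_d\ge\frac{1-p_x}{n}$. (iii) If no pair has distance outside $\{1,d\}$, then $p_d\ge \frac1n$.
   Context: Identify the plane with $\mathbb C$. A proper $4$-colouring of the plane is a map $c_0:\mathbb C\to\{1,2,3,4\}$ such that no two points at distance $1$ have the same colour. Let $S_4$ be the group of permutations of the colours and $E(2)$ the group of Euclidean isometries of the plane. The group $S_4\times E(2)$ is amenable, so there is a finitely additive probability measure $\mu$ defined on all subsets of $S_4\times E(2)$ which is left-invariant, i.e. $\mu(gE)=\mu(E)$ for all $g\in S_4\times E(2)$ and $E\subseteq S_4\times E(2)$. For $(\sigma,T)\in S_4\times E(2)$ consider the (random) colouring $c=\sigma\circ c_0\circ T^{-1}$. For $d\ge 0$, $p_d$ denotes the probability that two points $A,B$ at distance $d$ get the same colour: $p_d=\mu(\{(\sigma,T): c(A)=c(B)\})$; by left-invariance this does not depend on the choice of $A,B$ with $|AB|=d$. The existence of $c_0$ is a standing assumption, and $c_0,\mu$ are arbitrary but fixed. *)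

(* Defs.v *)
From HB Require Import structures.
From mathcomp Require Import all_boot all_order all_fingroup all_algebra.
From mathcomp Require Import boolp classical_sets reals.
From mathcomp Require Import complex.

Set Implicit Arguments.
Unset Strict Implicit.
Unset Printing Implicit Defensive.
Import Order.TTheory GRing.Theory Num.Theory.

Local Open Scope ring_scope.
Local Open Scope complex_scope.

(* The norm of R[i] is R[i]-valued (with zero imaginary part), hence Re. *)
Definition dist (R : realType) (A B : R[i]) : R := complex.Re `|A - B|.

Definition colour := 'I_4.

Definition proper_colouring (R : realType) (c0 : R[i] -> colour) : Prop :=
  forall A B : R[i], dist A B = 1 -> c0 A <> c0 B.

(* In MathComp, (s * t)%g x = t (s x) for permutations s and t. The alias S4
   carries the opposite law, (s * t)%g x = s (t x), so that left translations
   are post-compositions of colourings, as for isometries below. *)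
Definition S4 := {perm colour}.

Section S4Group.

Definition S4_mul (s t : S4) : S4 := mulg (t : {perm colour}) s.
Definition S4_one : S4 := (1%g : {perm colour}).
Definition S4_inv (s : S4) : S4 := invg (s : {perm colour}).

Fact S4_mulA : associative S4_mul.
Proof. by move=> x y z; rewrite /S4_mul mulgA. Qed.
Fact S4_mul1g : left_id S4_one S4_mul.
Proof. by move=> x; rewrite /S4_mul mulg1. Qed.
Fact S4_mulg1 : right_id S4_one S4_mul.
Proof. by move=> x; rewrite /S4_mul mul1g. Qed.
Fact S4_mulVg : left_inverse S4_one S4_inv S4_mul.
Proof. by move=> x; rewrite /S4_mul mulgV. Qed.
Fact S4_mulgV : right_inverse S4_one S4_inv S4_mul.
Proof. by move=> x; rewrite /S4_mul mulVg. Qed.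

HB.instance Definition _ := Choice.copy S4 {perm colour}.
HB.instance Definition _ :=
  isGroup.Build S4 S4_mulA S4_mul1g S4_mulg1 S4_mulVg S4_mulgV.

Lemma S4_mulE (s t : S4) x : (s * t)%g x = s (t x).
Proof. exact: permM. Qed.

End S4Group.

Record isometry (R : realType) := Isometry {
  isom_fun :> R[i] -> R[i];
  isom_inv : R[i] -> R[i];
  isom_funK : cancel isom_fun isom_inv;
  isom_invK : cancel isom_inv isom_fun;
  isom_dist : forall A B, dist (isom_fun A) (isom_fun B) = dist A B }.

Section IsometryGroup.
Variable R : realType.
Implicit Types T U : isometry R.

Lemma isometryP T U : (forall A, T A = U A) -> T = U.
Proof.
case: T U => [f g fK gK fd] [f' g' fK' gK' fd'] /= /funext ff'.
rewrite {}ff' in fK gK fd *.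
have gg' : g = g' by apply/funext => A; rewrite -{1}(gK' A) fK.
rewrite {}gg' in fK gK *.
by congr (@Isometry _ _ _ _ _ _); exact: Prop_irrelevance.
Qed.

Definition isom_one : isometry R :=
  @Isometry R id id (fun _ => erefl) (fun _ => erefl) (fun _ _ => erefl).

Fact isom_mul_dist T U A B : dist ((T \o U) A) ((T \o U) B) = dist A B.
Proof. by rewrite /= !isom_dist. Qed.

Definition isom_mul T U : isometry R :=
  Isometry (can_comp (@isom_funK R T) (@isom_funK R U))
    (can_comp (@isom_invK R U) (@isom_invK R T)) (isom_mul_dist T U).

Fact isom_inv_dist T A B : dist (isom_inv T A) (isom_inv T B) = dist A B.
Proof. by rewrite -(isom_dist T) !isom_invK. Qed.

Definition isom_invg T : isometry R :=
  Isometry (@isom_invK R T) (@isom_funK R T) (isom_inv_dist T).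

HB.instance Definition _ := gen_eqMixin (isometry R).
HB.instance Definition _ := gen_choiceMixin (isometry R).

Fact isom_mulA : associative isom_mul.
Proof. by move=> T U V; exact: isometryP. Qed.
Fact isom_mul1g : left_id isom_one isom_mul.
Proof. by move=> T; exact: isometryP. Qed.
Fact isom_mulg1 : right_id isom_one isom_mul.
Proof. by move=> T; exact: isometryP. Qed.
Fact isom_mulVg : left_inverse isom_one isom_invg isom_mul.
Proof. by move=> T; apply: isometryP => A /=; exact: isom_funK. Qed.
Fact isom_mulgV : right_inverse isom_one isom_invg isom_mul.
Proof. by move=> T; apply: isometryP => A /=; exact: isom_invK. Qed.

HB.instance Definition _ := isGroup.Build (isometry R)
  isom_mulA isom_mul1g isom_mulg1 isom_mulVg isom_mulgV.

End IsometryGroup.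

Definition S4xE2 (R : realType) : groupType := (S4 * isometry R)%type.

Lemma isometry_exists (R : realType) (A B : R[i]) :
  exists T : isometry R, T 0 = A /\ T (dist A B)%:C = B.
Proof.
have distE (C D : R[i]) : (dist C D)%:C = `|C - D| by rewrite /dist normc_def.
have [u u1 uE] : exists2 u : R[i], `|u| = 1 & u * `|A - B| = B - A.
  have [->|nAB] := eqVneq A B.
    by exists 1; rewrite ?normr1 // !subrr normr0 mulr0.
  have n0 : `|A - B| != 0 by rewrite normr_eq0 subr_eq0.
  exists ((B - A) / `|A - B|); last by rewrite divfK.
  by rewrite normrM normfV normr_id distrC divff.
have u0 : u != 0 by rewrite -normr_eq0 u1 oner_neq0.
have fK : cancel (fun z => u * z + A) (fun z => (z - A) / u).
  by move=> z /=; rewrite addrK mulrC mulKf.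
have gK : cancel (fun z => (z - A) / u) (fun z => u * z + A).
  by move=> z /=; rewrite mulrC divfK // subrK.
have fd C D : dist (u * C + A) (u * D + A) = dist C D.
  rewrite /dist; congr complex.Re.
  by rewrite opprD addrACA subrr addr0 -mulrBr normrM u1 mul1r.
exists (Isometry fK gK fd) => /=; split; first by rewrite mulr0 add0r.
by rewrite distE uE subrK.
Qed.

Section Measure.
Local Open Scope classical_set_scope.

Definition fin_add_probability (R : realType) (X : Type) (mu : set X -> R) :=
  [/\ forall E, 0 <= mu E,
      mu setT = 1 &
      forall E F, E `&` F = set0 -> mu (E `|` F) = mu E + mu F].

Definition left_invariant (R : realType) (G : groupType) (mu : set G -> R) :=
  forall (g : G) (E : set G), mu [set (g * h)%g | h in E] = mu E.

Definition random_colouring (R : realType) (c0 : R[i] -> colour)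
    (g : S4xE2 R) : R[i] -> colour :=
  g.1 \o c0 \o (g.2^-1)%g.

Definition same_colour (R : realType) (c0 : R[i] -> colour) (A B : R[i]) :
    set (S4xE2 R) :=
  [set g | random_colouring c0 g A = random_colouring c0 g B].

(* p_d, evaluated at the reference points 0 and d; any other pair of points at
   distance d gives the same value, see mono_probE. *)
Definition mono_prob (R : realType) (mu : set (S4xE2 R) -> R)
    (c0 : R[i] -> colour) (d : R) : R :=
  mu (same_colour c0 0 d%:C).

Lemma mono_probE (R : realType) (mu : set (S4xE2 R) -> R)
    (c0 : R[i] -> colour) (A B : R[i]) :
  left_invariant mu -> mu (same_colour c0 A B) = mono_prob mu c0 (dist A B).
Proof.
move=> mu_inv.
have [T [T0 TD]] := isometry_exists A B.
rewrite /mono_prob -(mu_inv (1%g, T) (same_colour c0 0 (dist A B)%:C)).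
congr mu; apply/seteqP; split=> [[s U] /= sUAB | _ [[s U] /= sU0D <-]].
  exists (s, T^-1 * U)%g; last first.
    by congr pair; rewrite /= ?mul1g ?mulKVg.
  rewrite /same_colour /random_colouring /= in sUAB *.
  by rewrite /= -T0 -TD in sUAB.
rewrite /same_colour /random_colouring /= in sU0D *.
by rewrite -[A]T0 -[B]TD !isom_funK mul1g.
Qed.

End Measure.

Section Pairs.
Variables (R : realType) (P : 'I_5 -> R[i]).

(* The pair {i, j} of indices is represented by (i, j) with i < j. *)
Definition pair_dist (e : 'I_5 * 'I_5) : R := dist (P e.1) (P e.2).

Definition pairs : {set 'I_5 * 'I_5} := [set e : 'I_5 * 'I_5 | (e.1 < e.2)%N]%SET.

Definition pairs_at (d : R) : {set 'I_5 * 'I_5} :=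
  [set e in pairs | pair_dist e == d]%SET.

Definition other_pairs (d : R) : {set 'I_5 * 'I_5} :=
  [set e in pairs | (pair_dist e != 1) && (pair_dist e != d)]%SET.

End Pairs.

(* Main.v *)
Require Import Defs.
From mathcomp Require Import all_boot all_order all_fingroup all_algebra.
From mathcomp Require Import boolp classical_sets reals.
From mathcomp Require Import complex.
Set Implicit Arguments.
Unset Strict Implicit.
Unset Printing Implicit Defensive.
Import Order.TTheory GRing.Theory Num.Theory.
Local Open Scope ring_scope.

(** Two of five points always share one of four colours, so the events "the two
    points of the pair [e] have the same colour" cover the whole probability
    space. Subadditivity bounds [1] by the sum of their probabilities: a pair
    at distance [1] contributes [0] and a pair at distance [d] contributes
    [p d]. *)

Section FinAddProbability.
Variables (R : realType) (X : Type) (mu : set X -> R).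
Hypothesis mu_prob : fin_add_probability mu.
Local Open Scope classical_set_scope.

(** The empty set is disjoint from itself, so additivity makes its measure equal to its own
    double. *)
Lemma fin_add_set0 : mu set0 = 0.
Proof.
case: mu_prob => _ _ muU.
by have /eqP := muU _ _ (set0I set0); rewrite setU0 addrC -subr_eq subrr => /eqP.
Qed.

(** Splitting both the union and [F] along [E] into disjoint parts shows that the two sides differ
    by the measure of the intersection, which is nonnegative. *)
Lemma fin_add_leU (E F : set X) : mu (E `|` F) <= mu E + mu F.
Proof.
case: mu_prob => mu_ge0 _ muU.
have -> : E `|` F = E `|` (F `\` E).
  apply/seteqP; split=> x /=; last tauto.
  by have [] := EM (E x); tauto.
have {2}-> : F = (F `&` E) `|` (F `\` E) by rewrite setUIDK.
rewrite !muU ?lerD2l ?lerDr ?mu_ge0 //; apply/seteqP; split=> x //=; tauto.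
Qed.

Lemma fin_add_le_sum (I : finType) (A : {set I}) (F : I -> set X) :
  mu [set x | exists2 i, i \in A & F i x] <= \sum_(i in A) mu (F i).
Proof.
(* Passing from [A] to its enumeration allows induction on a list, with one use of subadditivity per
   element. *)
rewrite -big_enum /=.
have -> : [set x | exists2 i, i \in A & F i x] =
          [set x | exists2 i, i \in enum A & F i x].
  by apply/seteqP; split=> x [i Ai Fix]; exists i; rewrite ?mem_enum // in Ai *.
elim: (enum A) => [|i s IHs].
  rewrite big_nil (_ : [set _ | _] = set0) ?fin_add_set0 //.
  by apply/seteqP; split=> x // [].
rewrite big_cons; apply: le_trans (lerD (lexx _) IHs).
rewrite (_ : [set _ | _] = F i `|` [set x | exists2 j, j \in s & F j x]).
  exact: fin_add_leU.
apply/seteqP; split=> x /=.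
  move=> [j]; rewrite inE => /orP[/eqP->|sj] Fjx; first by left.
  by right; exists j.
move=> [Fix|[j sj Fjx]]; first by exists i; rewrite ?mem_head.
by exists j; rewrite // inE sj orbT.
Qed.

End FinAddProbability.

Section MonochromaticPairs.
Variables (R : realType) (c0 : R[i] -> colour) (mu : set (S4xE2 R) -> R).
Hypotheses (c0_proper : proper_colouring c0) (mu_prob : fin_add_probability mu).
Hypothesis mu_inv : left_invariant mu.

(** The event is empty: a colour permutation is injective and an inverse isometry keeps the two
    points at distance 1, where [c0] takes different values. *)
Lemma mono_prob1 : mono_prob mu c0 1 = 0.
Proof.
rewrite -(fin_add_set0 mu_prob); congr mu; apply/seteqP; split=> // -[s T].
rewrite /same_colour /random_colouring /= => /perm_inj.
by apply: c0_proper; rewrite isom_inv_dist /dist sub0r normrN normr1.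
Qed.

Lemma same_colour_cover (P : 'I_5 -> R[i]) g :
  exists2 e, e \in pairs & same_colour c0 (P e.1) (P e.2) g.
Proof.
pose c i := random_colouring c0 g (P i).
have /injectivePn[i [j ij cij]] : ~~ injectiveb c.
  by apply/negP => /injectiveP/leq_card; rewrite !card_ord.
by have [ltij|ltji|/val_inj eqij] := ltngtP i j;
  [exists (i, j) | exists (j, i) | rewrite eqij eqxx in ij]; rewrite ?inE.
Qed.

Lemma mono_prob_pairs (P : 'I_5 -> R[i]) (d : R) :
  1 <= mono_prob mu c0 d * #|pairs_at P d|%:R
       + \sum_(e in other_pairs P d) mono_prob mu c0 (pair_dist P e).
Proof.
have [_ muT _] := mu_prob; rewrite -[leLHS]muT.
have -> : [set: S4xE2 R]%classic =
    [set g | exists2 e, e \in pairs & same_colour c0 (P e.1) (P e.2) g]%classic.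
  by apply/seteqP; split=> g // _; exact: same_colour_cover.
apply: le_trans (fin_add_le_sum mu_prob _ _) _.
(* By left-invariance each probability depends only on the distance of the pair. *)
under eq_bigr do rewrite mono_probE // -/(pair_dist P _).
(* Distance [d] is split off before distance 1, so that no pair is counted twice when [d = 1]. *)
rewrite (bigID (fun e => pair_dist P e == d)) /=; apply: lerD.
  rewrite mulr_natr -sumr_const le_eqVlt; apply/orP; left; apply/eqP.
  by apply: eq_big => [e|e /andP[_ /eqP->]//]; rewrite [in RHS]inE.
rewrite (bigID (fun e => pair_dist P e == 1)) /= big1 ?add0r.
  rewrite le_eqVlt; apply/orP; left; apply/eqP.
  by apply: eq_bigl => e; rewrite [in RHS]inE -andbA [(_ != d) && _]andbC.
by move=> e /andP[_ /eqP->]; exact: mono_prob1.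
Qed.

(* If no pair is at distance [d], the left-hand side is [0] since [x / 0 = 0]. *)
Lemma mono_prob_lower (P : 'I_5 -> R[i]) (d : R) :
  (1 - \sum_(e in other_pairs P d) mono_prob mu c0 (pair_dist P e))
    / #|pairs_at P d|%:R <= mono_prob mu c0 d.
Proof.
have [n0|n_gt0] := posnP #|pairs_at P d|.
  by rewrite n0 invr0 mulr0; have [mu_ge0 _ _] := mu_prob; exact: mu_ge0.
by rewrite ler_pdivrMr ?ltr0n // lerBlDr mono_prob_pairs.
Qed.

End MonochromaticPairs.

Theorem mainTheorem2 (R : realType) (c0 : R[i] -> colour)
    (mu : set (S4xE2 R) -> R) (d : R) (P : 'I_5 -> R[i]) :
  proper_colouring c0 ->
  fin_add_probability mu ->
  left_invariant mu ->
  0 < d ->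
  injective P ->
  (8 <= #|[set e in pairs | (pair_dist P e == 1%R) || (pair_dist P e == d)]%SET|)%N ->
  let p := mono_prob mu c0 in
  let n := #|pairs_at P d| in
  [/\ (forall e f x y,
         e != f -> other_pairs P d = [set e; f]%SET ->
         pair_dist P e = x -> pair_dist P f = y -> x <= y ->
         (1 - p x - p y) / n%:R <= p d),
      (forall e x,
         other_pairs P d = [set e]%SET -> pair_dist P e = x ->
         (1 - p x) / n%:R <= p d)
    & other_pairs P d = finset.set0 -> 1 / n%:R <= p d].
Proof.
move=> c0_proper mu_prob mu_inv _ _ _ p n.
(* All three claims are this bound, with a sum of two, one or no terms; [e != f] keeps the two terms
   separate. *)
have := mono_prob_lower c0_proper mu_prob mu_inv P d; rewrite -/p -/n => lower.
split=> [e f x y ef others <- <- _ | e x others <- | others].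
- by move: lower; rewrite others big_setU1 ?inE //= big_set1 opprD addrA.
- by move: lower; rewrite others big_set1.
- by move: lower; rewrite others big_set0 subr0.
Qed.
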